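(* There exist absolute constants $a,b>0$ such that the following holds. Let $0<\epsilon\le\Delta\le1$ and let $G$ be an $n\times n$ bimatrix game with payoffs in $[0,1]$ that has at most $n^{a(\Delta/\epsilon)^2}$ Nash equilibria and satisfies the well-supported $(\epsilon,\Delta)$-approximation stability condition (or the $(\epsilon/2,\Delta)$-stability to perturbations condition). Then: (1) every Nash equilibrium of $G$ is $8\Delta$-close to a pair of mixed strategies each with support of size at most $b(\Delta/\epsilon)^2\log(1+\Delta^{-1})\log n$; (2) for every game $G'$ within $L_\infty$ distance $\epsilon/2$ of $G$, every Nash equilibrium of $G'$ is $9\Delta$-close to a pair of mixed strategies each with support of size at most $b(\Delta/\epsilon)^2\log(1+\Delta^{-1})\log n$.
   Context: Bimatrix game: row payoff $R_{i,j}$, column payoff $C_{i,j}$; mixed strategies $p,q$ are probability vectors, payoffs $p^TRq$, $p^TCq$; $e_i$ is the $i$-th unit vector; $\mathrm{supp}(p)=\{i:p_i>0\}$. Nash equilibrium: $e_i^TRq\le p^TRq$ and $p^TCe_j\le p^TCq$ for all $i,j$. Well-supported $\epsilon$-equilibrium: for every $i\in\mathrm{supp}(p)$ and all $j$, $e_i^TRq\ge e_j^TRq-\epsilon$, and for every $i\in\mathrm{supp}(q)$ and all $j$, $p^TCe_i\ge p^TCe_j-\epsilon$. Distance $d(p,p')=\frac12\sum_i|p_i-p'_i|$, $d((p,q),(p',q'))=\max(d(p,p'),d(q,q'))$; $\Delta$-close means distance $\le\Delta$. $G'$ (matrices $R',C'$) is within $L_\infty$ distance $\alpha$ of $G$ (an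 $L_\infty$ $\alpha$-perturbation) if $|R_{i,j}-R'_{i,j}|\le\alpha$ and $|C_{i,j}-C'_{i,j}|\le\alpha$ for all $i,j$ (entries need not be in $[0,1]$). $(\epsilon,\Delta)$-stability to perturbations: for every $L_\infty$ $\epsilon$-perturbation $G'$ of $G$, every Nash equilibrium of $G'$ is $\Delta$-close to some Nash equilibrium of $G$. Well-supported $(\epsilon,\Delta)$-approximation stability: every well-supported $\epsilon$-equilibrium of $G$ is $\Delta$-close to some Nash equilibrium of $G$. $\log$ is natural.
   Formalization: The formal theorem assumes n ≥ 2: for n = 1 the bound involving log n is 0 while every mixed strategy has support of size 1, so the statement fails there. *)

(* Defs.v *)
From HB Require Import structures.
From mathcomp Require Import all_boot all_order all_algebra.
From mathcomp Require Import all_classical all_reals all_analysis.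
From mathcomp Require Import Rstruct.
Set Implicit Arguments. Unset Strict Implicit. Unset Printing Implicit Defensive.
Import Order.TTheory GRing.Theory Num.Theory.
Local Open Scope ring_scope.

Section Bimatrix.
Variable R : realType.
Variable n : nat.

Definition prob (p : {ffun 'I_n -> R}) : Prop :=
  (forall i, 0 <= p i) /\ \sum_i p i = 1.

Definition unitv (i : 'I_n) : {ffun 'I_n -> R} := [ffun j => (j == i)%:R].

Definition pay (A : 'M[R]_n) (p q : {ffun 'I_n -> R}) : R :=
  \sum_i \sum_j p i * A i j * q j.

Definition supp (p : {ffun 'I_n -> R}) : {set 'I_n} := [set i | 0 < p i].

Definition is_NE (Rm Cm : 'M[R]_n) (p q : {ffun 'I_n -> R}) : Prop :=
  [/\ prob p, prob q,
      (forall i, pay Rm (unitv i) q <= pay Rm p q) &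
      (forall j, pay Cm p (unitv j) <= pay Cm p q)].

Definition is_WSNE (eps : R) (Rm Cm : 'M[R]_n) (p q : {ffun 'I_n -> R}) : Prop :=
  [/\ prob p, prob q,
      (forall i, i \in supp p -> forall j,
          pay Rm (unitv j) q - eps <= pay Rm (unitv i) q) &
      (forall i, i \in supp q -> forall j,
          pay Cm p (unitv j) - eps <= pay Cm p (unitv i))].

Definition dist (p p' : {ffun 'I_n -> R}) : R :=
  2^-1 * \sum_i `|p i - p' i|.

Definition dist2 (p q p' q' : {ffun 'I_n -> R}) : R :=
  Num.max (dist p p') (dist q q').

Definition payoffs01 (Rm Cm : 'M[R]_n) : Prop :=
  forall i j, 0 <= Rm i j <= 1 /\ 0 <= Cm i j <= 1.

Definition perturb (alpha : R) (Rm Cm Rm' Cm' : 'M[R]_n) : Prop :=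
  forall i j, `|Rm i j - Rm' i j| <= alpha /\ `|Cm i j - Cm' i j| <= alpha.

Definition stable_pert (eps Delta : R) (Rm Cm : 'M[R]_n) : Prop :=
  forall Rm' Cm', perturb eps Rm Cm Rm' Cm' ->
  forall p q, is_NE Rm' Cm' p q ->
  exists p' q', is_NE Rm Cm p' q' /\ dist2 p q p' q' <= Delta.

Definition ws_approx_stable (eps Delta : R) (Rm Cm : 'M[R]_n) : Prop :=
  forall p q, is_WSNE eps Rm Cm p q ->
  exists p' q', is_NE Rm Cm p' q' /\ dist2 p q p' q' <= Delta.

Definition at_most_NE (K : R) (Rm Cm : 'M[R]_n) : Prop :=
  exists s : seq ({ffun 'I_n -> R} * {ffun 'I_n -> R}),
    (size s)%:R <= K /\ forall p q, is_NE Rm Cm p q -> (p, q) \in s.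

Definition close_small_support (Delta k : R) (p q : {ffun 'I_n -> R}) : Prop :=
  exists p' q', [/\ prob p', prob q',
    (#|supp p'|%:R <= k), (#|supp q'|%:R <= k) & dist2 p q p' q' <= Delta].

End Bimatrix.

(* Main.v *)
(** Equilibria of [eps/2]-perturbations are well-supported [eps]-equilibria, so
    the first stability notion implies the second. Let [(p, q)] be an
    equilibrium. If [p'] is supported in [supp p] and changes every column payoff
    by at most [eps/2], then [(p', q)] is an equilibrium of an
    [eps/2]-perturbation, so [p'] is [Delta]-close to one of the few equilibrium
    strategies. The strategy [q] is treated in the transposed game.

    Let [X = (Delta/eps)^2 ln n] and [m ~ 1536 X]. Repeatedly removing [m]-sets
    carrying at least [1/16] of the remaining mass of [p] leads, after
    [O(ln (1 + 1/Delta))] rounds, either to a remainder of mass at most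
    [8 Delta], in which case [p] is close to a strategy supported on the removed
    set, or to a remainder of mass above [8 Delta] in which every [m]-set has
    relative mass at most [1/16]. In the latter case replace mass [4 Delta] of
    the remainder by the empirical distribution of [m] samples from it: by a
    Hoeffding bound the result is admissible with probability at least [1/2],
    while two samples landing within [2 Delta] of each other must share half of
    their points, so each equilibrium is [Delta]-close to the result with
    probability at most [2^-m]. This forces more than [n^((Delta/eps)^2)]
    equilibria. *)

Require Import Defs.
From mathcomp Require Import all_boot all_order all_algebra.
From mathcomp Require Import all_classical all_reals all_analysis.
From mathcomp Require Import Rstruct.
From mathcomp Require Import ring lra.
Set Implicit Arguments. Unset Strict Implicit. Unset Printing Implicit Defensive.
Import Order.TTheory GRing.Theory Num.Theory.
Local Open Scope ring_scope.

(** * Exponential moments and independent samples *)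

(** [expR y] is at most the inverse of [1 - y], and [(1 + y + 2 * y ^+ 2) * (1 - y) = 1 + y ^+ 2 *
    (1 - 2 * y)] is at least 1 in this range. *)
Lemma expR_le_quadratic (R : realType) (y : R) :
  y <= 2^-1 -> expR y <= 1 + y + 2 * y ^+ 2.
Proof.
move=> y_le; have y1_gt0 : 0 < 1 - y by lra.
have : 1 - y <= expR (- y) by rewrite expR_ge1Dx.
rewrite expRN => le_inv.
have : expR y <= (1 - y)^-1.
  by rewrite -[expR y]invrK lef_pV2 // posrE invr_gt0 expR_gt0.
move=> /le_trans; apply.
rewrite -div1r ler_pdivrMr //; have := sqr_ge0 y; nra.
Qed.

(** Markov's inequality for samples [f] of weight [\prod_k w (f k)]: the mean of a product over the
    coordinates factorizes by distributivity. *)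
Lemma iid_markov (R : realType) (I : finType) (m : nat) (w g : I -> R)
    (P : pred {ffun 'I_m -> I}) (c : R) :
  (forall i, 0 <= w i) -> (forall i, 0 <= g i) ->
  (forall f, P f -> c <= \prod_k g (f k)) ->
  c * (\sum_(f | P f) \prod_k w (f k)) <= (\sum_i w i * g i) ^+ m.
Proof.
move=> w_ge0 g_ge0 Pc.
have -> : (\sum_i w i * g i) ^+ m =
    \sum_(f : {ffun 'I_m -> I}) \prod_k (w (f k) * g (f k)).
  rewrite -(bigA_distr_bigA (fun (_ : 'I_m) i => w i * g i)).
  by rewrite prodr_const card_ord.
rewrite mulr_sumr [leRHS](bigID P) /= ler_wpDr //.
  by apply: sumr_ge0 => f _; apply: prodr_ge0 => k _; apply: mulr_ge0.
apply: ler_sum => f Pf; rewrite big_split /= mulrC.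
by apply: ler_wpM2l; [apply: prodr_ge0 | apply: Pc].
Qed.

Lemma iid_total (R : realType) (I : finType) (m : nat) (w : I -> R) :
  \sum_i w i = 1 -> \sum_(f : {ffun 'I_m -> I}) \prod_k w (f k) = 1.
Proof.
move=> w1; rewrite -(bigA_distr_bigA (fun (_ : 'I_m) i => w i)).
by rewrite prodr_const w1 expr1n.
Qed.

(** Chernoff's method: Markov's inequality is applied to [expR (l * Y i)], and since [Y] has mean
    zero the linear term of the quadratic bound averages out. *)
Lemma iid_tail (R : realType) (I : finType) (m : nat) (w Y : I -> R) (t : R) :
  (forall i, 0 <= w i) -> \sum_i w i = 1 ->
  (forall i, `|Y i| <= 1) -> \sum_i w i * Y i = 0 -> 0 <= t <= 2 ->
  \sum_(f : {ffun 'I_m -> I} | t * m%:R < \sum_k Y (f k)) \prod_k w (f k)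
    <= expR (- (t ^+ 2 / 8 * m%:R)).
Proof.
move=> w_ge0 w1 Y1 wY /andP[t_ge0 t_le2].
(* This value minimizes [2 * l ^+ 2 - l * t], giving [- (t ^+ 2 / 8)]; [t <= 2] keeps [l * Y i] at
   most [2^-1], where the quadratic bound applies. *)
pose l := t / 4.
have l_ge0 : 0 <= l by rewrite /l; lra.
have le1 : expR (l * (t * m%:R)) *
    (\sum_(f : {ffun 'I_m -> I} | t * m%:R < \sum_k Y (f k)) \prod_k w (f k))
    <= (\sum_i w i * expR (l * Y i)) ^+ m.
  apply: iid_markov => // f /ltW tY.
  by rewrite -expR_sum ler_expR -mulr_sumr ler_wpM2l.
have le2 : (\sum_i w i * expR (l * Y i)) ^+ m <= expR (2 * l ^+ 2 * m%:R).
  rewrite expRM_natr; apply: lerXn2r; rewrite ?nnegrE ?expR_ge0 //.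
    by apply: sumr_ge0 => i _; rewrite mulr_ge0 ?expR_ge0.
  apply: le_trans (expR_ge1Dx _).
  have -> : 1 + 2 * l ^+ 2 =
      \sum_i (w i * (1 + 2 * l ^+ 2) + l * (w i * Y i)).
    by rewrite big_split /= -mulr_suml -mulr_sumr w1 wY; ring.
  apply: ler_sum => i _.
  have /andP[Yl Yu] : -1 <= Y i <= 1 by rewrite -ler_norml.
  have le_half : l * Y i <= 2^-1 by rewrite /l; nra.
  apply: (le_trans (ler_wpM2l (w_ge0 i) (expR_le_quadratic le_half))).
  have Y2 : Y i ^+ 2 <= 1 by nra.
  have l2 : 0 <= l ^+ 2 by apply: sqr_ge0.
  have : w i * (2 * (l * Y i) ^+ 2) <= w i * (2 * l ^+ 2).
    by apply: ler_wpM2l => //; rewrite exprMn; nra.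
  nra.
have := le_trans le1 le2.
rewrite mulrC -ler_pdivlMr ?expR_gt0 // -expRN -exp.expRD => /le_trans; apply.
by rewrite ler_expR le_eqVlt; apply/orP; left; apply/eqP; rewrite /l; field.
Qed.

Lemma iid_abs_tail (R : realType) (I : finType) (m : nat) (w Y : I -> R) (t : R) :
  (forall i, 0 <= w i) -> \sum_i w i = 1 ->
  (forall i, `|Y i| <= 1) -> \sum_i w i * Y i = 0 -> 0 <= t <= 2 ->
  \sum_(f : {ffun 'I_m -> I} | t * m%:R < `|\sum_k Y (f k)|) \prod_k w (f k)
    <= 2 * expR (- (t ^+ 2 / 8 * m%:R)).
Proof.
move=> w_ge0 w1 Y1 wY t02.
have F_ge0 (f : {ffun 'I_m -> I}) : 0 <= \prod_k w (f k) by apply: prodr_ge0.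
have up := iid_tail m w_ge0 w1 Y1 wY t02.
have dn : \sum_(f : {ffun 'I_m -> I} | t * m%:R < \sum_k - Y (f k))
    \prod_k w (f k) <= expR (- (t ^+ 2 / 8 * m%:R)).
  apply: (@iid_tail _ _ _ _ (fun i => - Y i)) => // [i|]; first by rewrite normrN.
  by under eq_bigr do rewrite mulrN; rewrite sumrN wY oppr0.
apply: le_trans (_ : _ <= _ + _) _; last first.
  by rewrite mulrDl mul1r; apply: lerD; [exact: up | exact: dn].
rewrite big_mkcond [X in _ <= X + _]big_mkcond [X in _ <= _ + X]big_mkcond.
rewrite -big_split; apply: ler_sum => f _ /=; rewrite sumrN lter_normr.
case: (t * m%:R < _) => /=; last by case: ifP => _; rewrite ?add0r.
by rewrite lerDl; case: ifP.
Qed.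

(** Give each hit the factor 16 and each miss the factor 1. Hitting [M] at least [m / 2] times makes
    the product at least [4 ^+ m], while the mean factor is at most [1 + 15 / 16 <= 2]. *)
Lemma iid_many_hits (R : realType) (I : finType) (m : nat) (w : I -> R)
    (M : {set I}) :
  (forall i, 0 <= w i) -> \sum_i w i = 1 -> \sum_(i in M) w i <= 16^-1 ->
  \sum_(f : {ffun 'I_m -> I} | (m <= 2 * #|[set k | f k \in M]|)%N)
    \prod_k w (f k) <= (2 ^+ m)^-1.
Proof.
move=> w_ge0 w1 wM.
have le1 : 4 ^+ m *
    (\sum_(f : {ffun 'I_m -> I} | (m <= 2 * #|[set k | f k \in M]|)%N)
      \prod_k w (f k)) <= (\sum_i w i * (if i \in M then 16 else 1)) ^+ m.
  apply: iid_markov => // [i|f hits]; first by case: ifP.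
  rewrite -big_mkcond /= prodr_const.
  have -> : (16 : R) = 4 ^+ 2 by rewrite expr2; ring.
  by rewrite -exprM ler_eXn2l ?ltr1n //; rewrite cardsE in hits.
have le2 : (\sum_i w i * (if i \in M then 16 else 1)) ^+ m <= 2 ^+ m.
  apply: lerXn2r; rewrite ?nnegrE //.
    by apply: sumr_ge0 => i _; case: ifP => _; rewrite ?mulr1 // mulr_ge0.
  have -> : \sum_i w i * (if i \in M then 16 else 1) =
      \sum_i w i + 15 * \sum_(i in M) w i.
    rewrite mulr_sumr (big_mkcond (mem M)) -big_split /=; apply: eq_bigr => i _.
    by case: ifP => _; ring.
  by rewrite w1; lra.
have := le_trans le1 le2.
have -> : (4 : R) = 2 * 2 by ring.
rewrite exprMn -mulrA -[leRHS]mulr1 ler_pM2l ?exprn_gt0 // => le3.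
by rewrite -[leRHS]mul1r ler_pdivlMr ?exprn_gt0 // mulrC.
Qed.

(** * Distance between strategies *)

Lemma dist_triangle (R : realType) (n : nat) (u v w : {ffun 'I_n -> R}) :
  dist u w <= dist u v + dist v w.
Proof.
rewrite /dist -mulrDr ler_wpM2l // -big_split /=.
by apply: ler_sum => i _; apply: ler_distD.
Qed.

Lemma distC (R : realType) (n : nat) (u v : {ffun 'I_n -> R}) :
  dist u v = dist v u.
Proof. by congr (_ * _); apply: eq_bigr => i _; rewrite distrC. Qed.

Lemma dist2_triangle (R : realType) (n : nat)
    (p q p' q' p'' q'' : {ffun 'I_n -> R}) :
  dist2 p q p'' q'' <= dist2 p q p' q' + dist2 p' q' p'' q''.
Proof.
rewrite /dist2 ge_max; apply/andP; split.
  apply: le_trans (dist_triangle p p' p'') _.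
  by apply: lerD; rewrite le_max lexx.
apply: le_trans (dist_triangle q q' q'') _.
by apply: lerD; rewrite le_max lexx orbT.
Qed.

(** As the totals agree, the excess of [u] on [A] equals its deficit off [A]; each is bounded by its
    own part of the l1-norm, whence the factor [2^-1]. *)
Lemma dist_ge_sum (R : realType) (n : nat) (A : {set 'I_n})
    (u v : {ffun 'I_n -> R}) :
  \sum_i u i = \sum_i v i -> \sum_(i in A) (u i - v i) <= dist u v.
Proof.
move=> uv.
have sumC : \sum_(i in A) (u i - v i) = - \sum_(i | i \notin A) (u i - v i).
  have : \sum_i (u i - v i) = 0 by rewrite sumrB uv subrr.
  by rewrite (bigID (mem A)) /= => /eqP; rewrite addr_eq0 => /eqP.
rewrite /dist mulrC ler_pdivlMr // [leRHS](bigID (mem A)) /= mulr_natr mulr2n {2}sumC.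
apply: lerD; last rewrite -sumrN; apply: ler_sum => i _; first exact: ler_norm.
by rewrite -normrN ler_norm.
Qed.

(** * Removing heavy sets and restricting to them *)

(** Induction on the number of rounds: if some [M] violates the spread condition, adding it to [H]
    multiplies the remaining mass by at most [1 - delta]; otherwise [H] is kept. *)
Lemma exists_heavy_set (R : realFieldType) (I : finType) (p : I -> R)
    (delta : R) (m T : nat) :
  (forall i, 0 <= p i) -> \sum_i p i = 1 -> 0 <= delta <= 1 ->
  exists H : {set I}, (#|H| <= T * m)%N /\
    (\sum_(i in ~: H) p i <= (1 - delta) ^+ T \/
     forall M : {set I}, (#|M| <= m)%N ->
       \sum_(i in M :\: H) p i <= delta * \sum_(i in ~: H) p i).
Proof.
move=> p_ge0 p1 /andP[delta_ge0 delta_le1].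
elim: T => [|T [H [cardH [tail|spread]]]].
- by exists finset.set0; rewrite cards0 finset.setC0; split=> //; left;
    under eq_bigl do rewrite finset.inE; rewrite p1 expr0.
- have [/forallP spread|] := boolP [forall M : {set I}, (#|M| <= m)%N ==>
      (\sum_(i in M :\: H) p i <= delta * \sum_(i in ~: H) p i)].
    exists H; split; first by rewrite (leq_trans cardH) // leq_mul2r leqnSn orbT.
    by right=> M cardM; have /implyP := spread M; apply.
  rewrite negb_forall => /existsP[M]; rewrite negb_imply -ltNge => /andP[cardM heavy].
  exists (H :|: M); split.
    by rewrite mulSn addnC (leq_trans (leq_card_setU _ _)) // leq_add.
  left.
  have -> : \sum_(i in ~: (H :|: M)) p i =
      \sum_(i in ~: H) p i - \sum_(i in M :\: H) p i.
    have inM : \sum_(i in ~: H | i \in M) p i = \sum_(i in M :\: H) p i.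
      by apply: eq_bigl => i; rewrite !finset.inE andbC.
    rewrite [in RHS](bigID (mem M)) /= inM addrAC subrr add0r.
    by apply: eq_bigl => i; rewrite !finset.inE negb_or.
  rewrite exprS; apply: (@le_trans _ _ ((1 - delta) * \sum_(i in ~: H) p i)).
    by rewrite mulrBl mul1r lerD2l lerN2 ltW.
  by rewrite ler_wpM2l // subr_ge0.
- exists H; split; last by right.
  by rewrite (leq_trans cardH) // leq_mul2r leqnSn orbT.
Qed.

(** Condition [p] on [H]: the mass lost outside [H] is gained inside, so half the l1-norm is exactly
    that mass. *)
Lemma restrict_close (R : realType) (n : nat) (p : {ffun 'I_n -> R})
    (H : {set 'I_n}) :
  prob p -> \sum_(i in ~: H) p i < 1 ->
  exists p', [/\ prob p', supp p' \subset H & dist p p' = \sum_(i in ~: H) p i].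
Proof.
move=> [p_ge0 p1]; set r := \sum_(i in ~: H) p i => r_lt1.
have r_ge0 : 0 <= r by apply: sumr_ge0.
have pH : \sum_(i in H) p i = 1 - r.
  have notinH : \sum_(i | i \notin H) p i = r.
    by apply: eq_bigl => i; rewrite finset.inE.
  by rewrite -p1 [in RHS](bigID (mem H)) /= notinH addrK.
have h_gt0 : 0 < 1 - r by rewrite subr_gt0.
exists [ffun i => if i \in H then p i / (1 - r) else 0]; split.
- split=> [i|].
    by rewrite ffunE; case: ifP => // _; rewrite divr_ge0 // ltW.
  under eq_bigr do rewrite ffunE.
  by rewrite -big_mkcond /= -mulr_suml pH mulfV // gt_eqF.
- by apply/fintype.subsetP => i; rewrite finset.inE ffunE; case: ifP => //; rewrite ltxx.
- have nrm i : `|p i - [ffun i => if i \in H then p i / (1 - r) else 0] i| =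
      if i \in H then p i * (r / (1 - r)) else p i.
    rewrite ffunE; case: ifP => _; last by rewrite subr0 ger0_norm.
    have -> : p i - p i / (1 - r) = - (p i * (r / (1 - r))).
      by field; rewrite gt_eqF.
    by rewrite normrN ger0_norm // mulr_ge0 // divr_ge0 // ltW.
  rewrite /dist (eq_bigr _ (fun i _ => nrm i)) (bigID (mem H)) /=.
  rewrite (eq_bigr (fun i => p i * (r / (1 - r)))); last by move=> i ->.
  rewrite -mulr_suml pH [X in _ + X](_ : _ = r).
    by field; rewrite gt_eqF.
  by apply: eq_big => [i|i /negPf ->//]; rewrite finset.inE.
Qed.

(** * Payoffs, equilibria and stability *)

Lemma pay_unitl (R : realType) (n : nat) (A : 'M[R]_n) i (q : {ffun 'I_n -> R}) :
  pay A (unitv R i) q = \sum_j A i j * q j.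
Proof.
rewrite /pay (bigD1 i) //= [X in _ + X]big1 ?addr0.
  by apply: eq_bigr => j _; rewrite ffunE eqxx mul1r.
by move=> k /negPf ki; rewrite big1 // => j _; rewrite ffunE ki !mul0r.
Qed.

Lemma pay_trmx (R : realType) (n : nat) (A : 'M[R]_n) (p q : {ffun 'I_n -> R}) :
  pay A^T q p = pay A p q.
Proof.
rewrite /pay exchange_big; apply: eq_bigr => i _; apply: eq_bigr => j _.
by rewrite mxE; ring.
Qed.

Lemma pay_unitr (R : realType) (n : nat) (A : 'M[R]_n) (p : {ffun 'I_n -> R}) j :
  pay A p (unitv R j) = \sum_i p i * A i j.
Proof.
by rewrite -pay_trmx pay_unitl; apply: eq_bigr => i _; rewrite mxE mulrC.
Qed.

Lemma pay_avgl (R : realType) (n : nat) (A : 'M[R]_n) (p q : {ffun 'I_n -> R}) :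
  pay A p q = \sum_i p i * pay A (unitv R i) q.
Proof.
rewrite [LHS]/pay; apply: eq_bigr => i _; rewrite pay_unitl mulr_sumr.
by apply: eq_bigr => j _; rewrite mulrA.
Qed.

Lemma pay_avgr (R : realType) (n : nat) (A : 'M[R]_n) (p q : {ffun 'I_n -> R}) :
  pay A p q = \sum_j q j * pay A p (unitv R j).
Proof.
by rewrite -pay_trmx pay_avgl; apply: eq_bigr => j _; rewrite pay_trmx.
Qed.

(** Exchanging the players lets each statement about the column player be deduced from the one about
    the row player. *)
Lemma NE_tr (R : realType) (n : nat) (Rm Cm : 'M[R]_n) (p q : {ffun 'I_n -> R}) :
  is_NE Rm Cm p q -> is_NE Cm^T Rm^T q p.
Proof. by case=> *; split=> // i; rewrite !pay_trmx. Qed.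

(** The gaps to the equilibrium payoff are nonnegative and their [p]-average is zero, so each gap of
    positive weight vanishes. *)
Lemma NE_suppl (R : realType) (n : nat) (Rm Cm : 'M[R]_n)
    (p q : {ffun 'I_n -> R}) i :
  is_NE Rm Cm p q -> i \in supp p -> pay Rm (unitv R i) q = pay Rm p q.
Proof.
move=> [[p_ge0 p1] _ br _]; rewrite finset.inE => pi_gt0.
have gap_ge0 k : 0 <= p k * (pay Rm p q - pay Rm (unitv R k) q).
  by rewrite mulr_ge0 // subr_ge0.
have /eqP : \sum_k p k * (pay Rm p q - pay Rm (unitv R k) q) = 0.
  under eq_bigr do rewrite mulrBr.
  by rewrite sumrB -mulr_suml p1 mul1r -pay_avgl subrr.
rewrite psumr_eq0 // => /allP/(_ i)/(_ (mem_index_enum _))/implyP/(_ isT).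
by rewrite mulf_eq0 gt_eqF //= subr_eq0 => /eqP.
Qed.

(** Strategies in the support are exact best replies in the perturbed game, and each of the two
    payoffs compared moves by at most [eps / 2]. *)
Lemma NE_perturb_WSNE (R : realType) (n : nat) (eps : R)
    (Rm Cm Rm' Cm' : 'M[R]_n) (p q : {ffun 'I_n -> R}) :
  perturb (eps / 2) Rm Cm Rm' Cm' -> is_NE Rm' Cm' p q -> is_WSNE eps Rm Cm p q.
Proof.
suff half (A B A' B' : 'M[R]_n) u v : perturb (eps / 2) A B A' B' ->
    is_NE A' B' u v -> forall i, i \in supp u -> forall j,
    pay A (unitv R j) v - eps <= pay A (unitv R i) v.
  move=> pert ne; split; [by case: ne | by case: ne | exact: half pert ne |].
  have pert' : perturb (eps / 2) Cm^T Rm^T Cm'^T Rm'^T.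
    by move=> i j; case: (pert j i); rewrite !mxE.
  move=> i iq j; have := half _ _ _ _ _ _ pert' (NE_tr ne) i iq j.
  by rewrite !pay_trmx.
move=> pert ne i iu j.
have [_ [v_ge0 v1] br _] := ne.
have near k : `|pay A (unitv R k) v - pay A' (unitv R k) v| <= eps / 2.
  rewrite !pay_unitl -sumrB (le_trans (ler_norm_sum _ _ _)) //.
  rewrite [leRHS](_ : _ = \sum_l eps / 2 * v l); last by rewrite -mulr_sumr v1 mulr1.
  apply: ler_sum => l _.
  rewrite -mulrBl normrM (ger0_norm (v_ge0 l)) ler_wpM2r //.
  by case: (pert k l).
have := br j; rewrite -(NE_suppl ne iu).
by move: (near i) (near j); rewrite !ler_norml => /andP[? ?] /andP[? ?]; lra.
Qed.

(* Subtracting from column [j] of [Cm] the change of its payoff makes [(p', q)]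
   an exact equilibrium of a perturbed game. *)
Lemma NE_shift_row (R : realType) (n : nat) (eps : R) (Rm Cm : 'M[R]_n)
    (p q p' : {ffun 'I_n -> R}) :
  0 <= eps -> is_NE Rm Cm p q -> prob p' -> supp p' \subset supp p ->
  (forall j, `|pay Cm p' (unitv R j) - pay Cm p (unitv R j)| <= eps) ->
  exists Cm', perturb eps Rm Cm Rm Cm' /\ is_NE Rm Cm' p' q.
Proof.
move=> eps_ge0 ne p'_prob sub close; have [_ q_prob brR brC] := ne.
have [p'_ge0 p'1] := p'_prob.
pose Cm' : 'M[R]_n :=
  \matrix_(i, j) (Cm i j - (pay Cm p' (unitv R j) - pay Cm p (unitv R j))).
have payC' j : pay Cm' p' (unitv R j) = pay Cm p (unitv R j).
  rewrite pay_unitr; under eq_bigr do rewrite mxE mulrBr.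
  by rewrite sumrB -pay_unitr -mulr_suml p'1 mul1r subKr.
(* [p'] mixes only best replies to [q], so the row player stays at the equilibrium payoff. *)
have payR : pay Rm p' q = pay Rm p q.
  rewrite pay_avgl -[RHS]mul1r -p'1 mulr_suml; apply: eq_bigr => i _.
  have [ip'|] := boolP (i \in supp p').
    by rewrite (NE_suppl ne) //; apply: (fintype.subsetP sub).
  rewrite finset.inE -leNgt => p'i_le0.
  have p'i0 : p' i = 0 by apply/eqP; rewrite eq_le p'i_le0 p'_ge0.
  by rewrite p'i0 !mul0r.
exists Cm'; split.
  by move=> i j; rewrite subrr normr0 mxE subKr.
split=> // [i|j]; first by rewrite payR.
rewrite payC' [leRHS]pay_avgr; under eq_bigr do rewrite payC'.
by rewrite -pay_avgr.
Qed.

Lemma stable_pert_tr (R : realType) (n : nat) (eps Delta : R) (Rm Cm : 'M[R]_n) :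
  stable_pert eps Delta Rm Cm -> stable_pert eps Delta Cm^T Rm^T.
Proof.
move=> stab A B pert p q /NE_tr/stab[].
  by move=> i j; case: (pert j i); rewrite !mxE.
by move=> q' [p' [/NE_tr ne close]]; exists p', q'; rewrite /dist2 maxC.
Qed.

Lemma ws_approx_stable_pert (R : realType) (n : nat) (eps Delta : R)
    (Rm Cm : 'M[R]_n) :
  ws_approx_stable eps Delta Rm Cm -> stable_pert (eps / 2) Delta Rm Cm.
Proof. by move=> stab A B pert p q /(NE_perturb_WSNE pert)/stab. Qed.

(** * Resampling part of a strategy *)

Definition empirical (R : realType) (n m : nat) (f : {ffun 'I_m -> 'I_n})
    (i : 'I_n) : R := m%:R^-1 * \sum_k (f k == i)%:R.

Lemma empirical_ge0 (R : realType) (n m : nat) (f : {ffun 'I_m -> 'I_n}) i :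
  0 <= empirical R f i.
Proof. by rewrite mulr_ge0 ?invr_ge0 // sumr_ge0. Qed.

Lemma empirical_avg (R : realType) (n m : nat) (f : {ffun 'I_m -> 'I_n})
    (h : 'I_n -> R) :
  \sum_i empirical R f i * h i = m%:R^-1 * \sum_k h (f k).
Proof.
under eq_bigr do rewrite /empirical -mulrA mulr_suml.
rewrite -mulr_sumr exchange_big /=; congr (_ * _); apply: eq_bigr => k _.
rewrite (bigD1 (f k)) //= eqxx mul1r big1 ?addr0 // => i.
by rewrite eq_sym => /negPf ->; rewrite mul0r.
Qed.

(** When [beta * w] lies below [p], this replaces a portion of [p] of mass [beta] and law [w] by the
    sample [f]. *)
Definition resample (R : realType) (n m : nat) (p : {ffun 'I_n -> R})
    (w : 'I_n -> R) (beta : R) (f : {ffun 'I_m -> 'I_n}) : {ffun 'I_n -> R} :=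
  [ffun i => p i + beta * (empirical R f i - w i)].

(** Payoffs change by [beta] times the deviation of the sample mean from the [w]-mean, the quantity
    controlled by the tail bound. *)
Lemma resample_avg (R : realType) (n m : nat) (p : {ffun 'I_n -> R})
    (w : 'I_n -> R) (beta : R) (f : {ffun 'I_m -> 'I_n}) (h : 'I_n -> R) :
  (0 < m)%N ->
  \sum_i resample p w beta f i * h i = \sum_i p i * h i +
    beta / m%:R * \sum_k (h (f k) - \sum_i w i * h i).
Proof.
move=> m_gt0; have m_neq0 : m%:R != 0 :> R by rewrite pnatr_eq0 -lt0n.
have -> : beta / m%:R * \sum_k (h (f k) - \sum_i w i * h i) =
    beta * (\sum_i empirical R f i * h i - \sum_i w i * h i).
  by rewrite empirical_avg sumrB sumr_const card_ord -[_ *+ m]mulr_natl; field.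
rewrite -sumrB mulr_sumr -big_split /=.
by apply: eq_bigr => i _; rewrite ffunE; ring.
Qed.

Lemma resample_total (R : realType) (n m : nat) (p : {ffun 'I_n -> R})
    (w : 'I_n -> R) (beta : R) (f : {ffun 'I_m -> 'I_n}) :
  (0 < m)%N -> \sum_i w i = 1 ->
  \sum_i resample p w beta f i = \sum_i p i.
Proof.
move=> m_gt0 w1; have := resample_avg p w beta f (fun=> 1) m_gt0.
rewrite -!mulr_suml !mulr1 w1 => ->.
by rewrite [X in _ * X]big1 ?mulr0 ?addr0 // => k _; rewrite subrr.
Qed.

Lemma resample_prob (R : realType) (n m : nat) (p : {ffun 'I_n -> R})
    (w : 'I_n -> R) (beta : R) (f : {ffun 'I_m -> 'I_n}) :
  (0 < m)%N -> prob p -> 0 <= beta -> (forall i, beta * w i <= p i) ->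
  \sum_i w i = 1 -> prob (resample p w beta f).
Proof.
move=> m_gt0 [p_ge0 p1] beta_ge0 wp w1; split=> [i|].
  rewrite ffunE; have := wp i; have := mulr_ge0 beta_ge0 (empirical_ge0 R f i).
  by rewrite mulrBr; lra.
by rewrite resample_total.
Qed.

Lemma resample_supp (R : realType) (n m : nat) (p : {ffun 'I_n -> R})
    (w : 'I_n -> R) (beta : R) (f : {ffun 'I_m -> 'I_n}) :
  0 <= beta -> (forall i, 0 <= w i) -> (forall k, f k \in supp p) ->
  supp (resample p w beta f) \subset supp p.
Proof.
move=> beta_ge0 w_ge0 fp; apply/fintype.subsetP => i; apply: contraLR => ip.
have emp0 : empirical R f i = 0.
  rewrite /empirical big1 ?mulr0 // => k _; case: eqP => // fki.
  by rewrite -fki fp in ip.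
move: ip; rewrite !finset.inE ffunE emp0 -!leNgt sub0r mulrN subr_le0 => /le_trans.
by apply; apply: mulr_ge0.
Qed.

(** Off the image of [g] the two strategies differ by [beta] times the empirical law of [f]. The
    distance therefore bounds from above [beta] times the fraction of samples of [f] missing that
    image. *)
Lemma resample_hits (R : realType) (n m : nat) (p : {ffun 'I_n -> R})
    (w : 'I_n -> R) (beta : R) (f g : {ffun 'I_m -> 'I_n}) :
  (0 < m)%N -> 0 < beta -> \sum_i w i = 1 ->
  dist (resample p w beta f) (resample p w beta g) <= beta / 2 ->
  (m <= 2 * #|[set k | f k \in g @: [set: 'I_m]]|)%N.
Proof.
move=> m_gt0 beta_gt0 w1 near; set M := g @: _.
have m_pos : 0 < m%:R :> R by rewrite ltr0n.
have := dist_ge_sum (~: M) 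
  (etrans (resample_total p beta f m_gt0 w1) (esym (resample_total p beta g m_gt0 w1))).
have -> : \sum_(i in ~: M) (resample p w beta f i - resample p w beta g i) =
    beta * (\sum_i empirical R f i * (i \notin M)%:R).
  rewrite big_mkcond mulr_sumr; apply: eq_bigr => i _; rewrite finset.inE.
  case: ifP => iM; last by rewrite mulr0 mulr0.
  have emp0 : empirical R g i = 0.
    rewrite /empirical big1 ?mulr0 // => k _; case: eqP => // gki.
    by rewrite -gki imset_f // in iM.
  by rewrite !ffunE emp0 mulr1n mulr1; ring.
have miss : \sum_k (f k \notin M)%:R = m%:R - #|[set k | f k \in M]|%:R :> R.
  have := cardsC [set k | f k \in M]; rewrite card_ord => /(congr1 (GRing.natmul (1 : R))).
  rewrite natrD => <-; rewrite addrAC subrr add0r -sum1_card natr_sum [RHS]big_mkcond.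
  by apply: eq_bigr => k _; rewrite !finset.inE; case: ifP.
rewrite empirical_avg miss => /le_trans/(_ near).
rewrite ler_pM2l // mulrC ler_pdivrMr // => le_half.
by rewrite -(ler_nat R) natrM; lra.
Qed.

(** * Few centers cannot cover all resamplings *)

(** Union bound over two families of events; the cover is asked only at samples of positive weight,
    which for products means that all sampled points have positive weight. *)
Lemma sum_le_cover (R : realType) (I : finType) (J K : Type) (s : seq J) (r : seq K)
    (F : I -> R) (P : J -> pred I) (Q : K -> pred I) :
  (forall f, 0 <= F f) ->
  (forall f, 0 < F f -> has (P^~ f) s \/ has (Q^~ f) r) ->
  \sum_f F f <= \sum_(x <- s) \sum_(f | P x f) F f
              + \sum_(x <- r) \sum_(f | Q x f) F f.
Proof.
move=> F_ge0 cover.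
have single (T : Type) (u : seq T) (S : T -> pred I) f : has (S^~ f) u ->
    F f <= \sum_(x <- u) if S x f then F f else 0.
  elim: u => //= x u IH; rewrite big_cons; case: ifP => [_ _|_ /=]; last by rewrite add0r.
  by rewrite lerDl sumr_ge0 // => y _; case: ifP.
have nonneg (T : Type) (u : seq T) (S : T -> pred I) f :
    0 <= \sum_(x <- u) if S x f then F f else 0.
  by apply: sumr_ge0 => x _; case: ifP.
under [X in _ <= X + _]eq_bigr do rewrite big_mkcond.
under [X in _ <= _ + X]eq_bigr do rewrite big_mkcond.
rewrite exchange_big [X in _ <= _ + X]exchange_big -big_split /=.
apply: ler_sum => f _; have [F_gt0|F_le0] := ltP 0 (F f).
  case: (cover f F_gt0) => /single h; first exact: ler_wpDr.
  exact: ler_wpDl.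
by apply: (le_trans F_le0); apply: addr_ge0.
Qed.

(** Each sample either disturbs some column payoff too much, which the Hoeffding term counts over
    the [n] columns, or is close to one of the centers in [s], each accounting for at most
    [2 ^- m]. *)
Lemma few_centers_bound (R : realType) (n m : nat) (C : 'M[R]_n) (eps Delta : R)
    (p : {ffun 'I_n -> R}) (H : {set 'I_n}) (s : seq {ffun 'I_n -> R}) :
  (0 < m)%N -> prob p -> (forall i j, 0 <= C i j <= 1) ->
  0 < eps -> eps <= Delta -> 8 * Delta < \sum_(i in ~: H) p i ->
  (forall M : {set 'I_n}, (#|M| <= m)%N ->
     \sum_(i in M :\: H) p i <= 16^-1 * \sum_(i in ~: H) p i) ->
  (forall p', prob p' -> supp p' \subset supp p ->
     (forall j, `|pay C p' (unitv R j) - pay C p (unitv R j)| <= eps / 2) ->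
     has (fun x => dist p' x <= Delta) s) ->
  1 <= n%:R * (2 * expR (- ((eps / (8 * Delta)) ^+ 2 / 8 * m%:R)))
       + (size s)%:R * (2 ^+ m)^-1.
Proof.
move=> m_gt0 p_prob C01 eps_gt0 eps_le; set L := \sum_(i in _) _ => L_gt spread cover.
have [p_ge0 p1] := p_prob; have D_gt0 : 0 < Delta by apply: lt_le_trans eps_le.
have L_gt0 : 0 < L by apply: lt_trans L_gt; lra.
have m_pos : 0 < m%:R :> R by rewrite ltr0n.
pose w i := if i \in ~: H then p i / L else 0.
have w_ge0 i : 0 <= w i by rewrite /w; case: ifP => // _; rewrite divr_ge0 // ltW.
have w1 : \sum_i w i = 1.
  by rewrite -big_mkcond /= -mulr_suml mulfV // gt_eqF.
(* The resampled mass is [4 * Delta], so that two results within [Delta] of a common center are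
   within half of it; [L > 8 * Delta] makes this much mass available. *)
have wp i : 4 * Delta * w i <= p i.
  rewrite /w; case: ifP => _; last by rewrite mulr0.
  by rewrite mulrA ler_pdivrMr // mulrC ler_wpM2l //; lra.
have wM (M : {set 'I_n}) : (#|M| <= m)%N -> \sum_(i in M) w i <= 16^-1.
  move=> /spread; rewrite -ler_pdivrMr //; apply: le_trans.
  rewrite mulr_suml big_mkcond [leRHS]big_mkcond le_eqVlt; apply/orP; left; apply/eqP.
  by apply: eq_bigr => i _; rewrite /w !finset.inE; case: (i \in M); case: (i \in H).
have w_supp i : 0 < w i -> i \in supp p.
  rewrite /w; case: ifP => _; last by rewrite ltxx.
  by rewrite finset.inE pmulr_lgt0 // invr_gt0.
(* Chosen so that [4 * Delta * t = eps / 2], the allowed change of a column payoff. *)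
pose t := eps / (8 * Delta).
have t02 : 0 <= t <= 2.
  by apply/andP; split; [rewrite divr_ge0 //; lra | rewrite ler_pdivrMr; lra].
pose mean j := \sum_i w i * C i j.
have mean01 j : 0 <= mean j <= 1.
  apply/andP; split.
    by apply: sumr_ge0 => i _; rewrite mulr_ge0 //; case/andP: (C01 i j).
  rewrite -[leRHS]w1; apply: ler_sum => i _.
  by rewrite -[leRHS]mulr1 ler_wpM2l //; case/andP: (C01 i j).
pose F (f : {ffun 'I_m -> 'I_n}) := \prod_k w (f k).
have F_ge0 f : 0 <= F f by apply: prodr_ge0.
pose res (f : {ffun 'I_m -> 'I_n}) := resample p w (4 * Delta) f.
pose bad j (f : {ffun 'I_m -> 'I_n}) := t * m%:R < `|\sum_k (C (f k) j - mean j)|.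
pose near x (f : {ffun 'I_m -> 'I_n}) := (0 < F f) && (dist (res f) x <= Delta).
have total : 1 <= \sum_(j <- enum 'I_n) \sum_(f | bad j f) F f
                + \sum_(x <- s) \sum_(f | near x f) F f.
  rewrite -(iid_total m w1); apply: sum_le_cover => // f F_gt0.
  have [|good] := boolP (has (bad^~ f) (enum 'I_n)); [by left | right].
  have w_gt0 k : 0 < w (f k).
    rewrite lt0r w_ge0 andbT; apply: contraTneq F_gt0 => wk0.
    by rewrite (bigD1 k) //= wk0 mul0r ltxx.
  have /hasP[x xs close] : has (fun x => dist (res f) x <= Delta) s.
    apply: cover.
    - by apply: resample_prob => //; lra.
    - by apply: resample_supp => // [|k]; [lra | exact: w_supp].
    move=> j; rewrite !pay_unitr resample_avg // [X in `|X|]addrC addKr.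
    have /hasPn/(_ j) := good; rewrite mem_enum => /(_ isT); rewrite -leNgt => goodj.
    rewrite normrM ger0_norm; last by rewrite divr_ge0 //; lra.
    apply: le_trans (ler_wpM2l _ goodj) _; first by rewrite divr_ge0 //; lra.
    by rewrite le_eqVlt; apply/orP; left; apply/eqP; rewrite /t; field; rewrite !gt_eqF.
  by apply/hasP; exists x => //; rewrite /near close andbT.
have const_sum (T : Type) (u : seq T) (c : R) : (size u)%:R * c = \sum_(x <- u) c.
  by rewrite big_const_seq count_predT iter_addr_0 mulr_natl.
apply: (le_trans total); apply: lerD.
  rewrite -[X in _ <= X%:R * _](size_enum_ord n) const_sum; apply: ler_sum => j _.
  apply: (@iid_abs_tail _ _ _ _ (fun i => C i j - mean j)) => // [i|].
    have /andP[? ?] := mean01 j; have /andP[? ?] := C01 i j.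
    by rewrite ler_norml; lra.
  by under eq_bigr do rewrite mulrBr; rewrite sumrB -mulr_suml w1 mul1r subrr.
rewrite const_sum; apply: ler_sum => x _.
(* Fix one sample [g] close to [x]: every other one must have at least half of its points among the
   at most [m] points of [g], a set of [w]-mass at most [16^-1]. *)
case: (pickP (near x)) => [g /andP[_ gx]|none]; last first.
  by rewrite big_pred0 // invr_ge0 exprn_ge0.
apply: le_trans (iid_many_hits m w_ge0 w1 (M := g @: [set: 'I_m]) _); last first.
  by apply: wM; rewrite (leq_trans (leq_imset_card _ _)) // cardsT card_ord.
rewrite big_mkcond [leRHS]big_mkcond; apply: ler_sum => f _.
case: ifP => [/andP[_ fx]|_]; last by case: ifP => _ //; apply: F_ge0.
rewrite (_ : (m <= _)%N) //; apply: (@resample_hits _ _ _ p w (4 * Delta)) => //.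
  lra.
apply: le_trans (dist_triangle _ x _) _; rewrite [dist x _]distC.
by apply: le_trans (lerD fx gx) _; lra.
Qed.

(* The extra point avoids the degenerate case where [H] carries no mass. *)
Lemma concentrate (R : realType) (n : nat) (p : {ffun 'I_n -> R})
    (H : {set 'I_n}) :
  prob p -> exists p', [/\ prob p', (#|supp p'| <= #|H|.+1)%N &
    dist p p' <= \sum_(i in ~: H) p i].
Proof.
move=> p_prob; have [p_ge0 p1] := p_prob.
have [i pi_gt0] : exists i, 0 < p i.
  apply/existsP; apply: contraT; rewrite negb_exists => /forallP p_le0.
  have : \sum_i p i <= 0 by apply: sumr_le0 => i _; rewrite leNgt.
  by rewrite p1 ler10.
have tail : \sum_(j in ~: (i |: H)) p j + p i * (i \notin H)%:R
    = \sum_(j in ~: H) p j.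
  have [iH|iH] := boolP (i \in H).
    by rewrite mulr0 addr0 (finset.setUidPr _) // finset.sub1set.
  rewrite mulr1 [RHS](bigD1 i) /= ?finset.inE // addrC; congr (_ + _).
  by apply: eq_bigl => j; rewrite !finset.inE negb_or andbC.
have tail_lt1 : \sum_(j in ~: (i |: H)) p j < 1.
  rewrite -p1 [ltRHS](bigID (mem (i |: H))) /=.
  rewrite [X in _ + X](_ : _ = \sum_(j in ~: (i |: H)) p j); last first.
    by apply: eq_bigl => j; rewrite finset.in_setC.
  by rewrite ltrDr (bigD1 i) /= ?finset.setU11 // ltr_pwDl // sumr_ge0.
have [p' [p'_prob sub close]] := restrict_close p_prob tail_lt1.
exists p'; split=> //.
  rewrite (leq_trans (subset_leq_card sub)) // cardsU1 -addn1 addnC leq_add2l.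
  by case: (i \in H).
by rewrite close -tail lerDl mulr_ge0.
Qed.

(** * Choice of constants and the support bound for one strategy *)

Lemma half_le_ln (R : realType) (x : R) : 2 <= x -> 2^-1 <= ln x.
Proof.
move=> x_ge2; rewrite -ler_expR lnK ?posrE; last by lra.
by apply: le_trans (expR_le_quadratic (lexx _)) _; lra.
Qed.

Lemma expR_half_nat_le (R : realType) (m : nat) :
  expR (2^-1 * m%:R) <= 2 ^+ m :> R.
Proof.
rewrite expRM_natr lerXn2r ?nnegrE ?expR_ge0 //.
by apply: le_trans (expR_le_quadratic (lexx _)) _; lra.
Qed.

(** Heavy sets are removed from [p]; a spread remainder of mass above [8 * Delta] would contradict
    the counting bound, so [p] can be concentrated on the removed set. *)
Lemma cover_small_support (R : realType) (n : nat) (C : 'M[R]_n) (eps Delta : R)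
    (p : {ffun 'I_n -> R}) (s : seq {ffun 'I_n -> R}) :
  (2 <= n)%N -> 0 < eps -> eps <= Delta -> Delta <= 1 -> prob p ->
  (forall i j, 0 <= C i j <= 1) ->
  (size s)%:R <= n%:R `^ ((Delta / eps) ^+ 2) ->
  (forall p', prob p' -> supp p' \subset supp p ->
     (forall j, `|pay C p' (unitv R j) - pay C p (unitv R j)| <= eps / 2) ->
     has (fun x => dist p' x <= Delta) s) ->
  exists p', [/\ prob p',
    #|supp p'|%:R <= (128 * 256) * (Delta / eps) ^+ 2 * ln (1 + Delta^-1) * ln n%:R
    & dist p p' <= 8 * Delta].
Proof.
move=> n_ge2 eps_gt0 eps_le D_le1 p_prob C01 size_s cover.
have [p_ge0 p1] := p_prob.
have D_gt0 : 0 < Delta by apply: lt_le_trans eps_le.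
have n_pos : 2 <= n%:R :> R by rewrite ler_nat.
set d := (Delta / eps) ^+ 2.
have d_ge1 : 1 <= d by rewrite exprn_ege1 // ler_pdivlMr ?mul1r.
have ln_n := half_le_ln n_pos.
set l := ln (1 + Delta^-1).
have l_ge : 2^-1 <= l.
  by apply: half_le_ln; rewrite -[2]/(1 + 1) lerD2l invr_ge1 ?unitf_gt0.
set X := d * ln n%:R.
have X_ge : 2^-1 <= X by rewrite /X; nra.
(* Here [1536 = 3 * 512] turns the Hoeffding factor into at most [n%:R ^- 3], and [16 * l] rounds at
   rate [1 - 16^-1] bring the mass down to [expR (- l)]. The successors make both bounds strict;
   they cost at most [2 * X] and [2 * l] since [X] and [l] are at least [2^-1]. *)
pose m := (Num.truncn (1536 * X)).+1; pose T := (Num.truncn (16 * l)).+1.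
have m_gt : 1536 * X < m%:R by apply: truncnS_gt.
have m_le : m%:R <= 1538 * X.
  have : (Num.truncn (1536 * X))%:R <= 1536 * X by rewrite truncn_le; lra.
  by rewrite /m -natr1; lra.
have T_gt : 16 * l < T%:R by apply: truncnS_gt.
have T_le : T%:R <= 18 * l.
  have : (Num.truncn (16 * l))%:R <= 16 * l by rewrite truncn_le; lra.
  by rewrite /T -natr1; lra.
have [H [cardH alt]] : exists H : {set 'I_n}, (#|H| <= T * m)%N /\
    (\sum_(i in ~: H) p i <= (1 - 16^-1) ^+ T \/
     forall M : {set 'I_n}, (#|M| <= m)%N ->
       \sum_(i in M :\: H) p i <= 16^-1 * \sum_(i in ~: H) p i).
  by apply: exists_heavy_set => //; lra.
have tail : \sum_(i in ~: H) p i <= 8 * Delta.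
  case: alt => [|spread].
    move/le_trans; apply.
    apply: (@le_trans _ _ (expR (- l))).
      apply: (@le_trans _ _ (expR (- 16^-1 * T%:R))); last by rewrite ler_expR; lra.
      rewrite expRM_natr lerXn2r ?nnegrE ?expR_ge0 //; first lra.
      exact: expR_ge1Dx.
    (* [expR (- l)] is the inverse of [1 + Delta^-1], which is below [Delta]. *)
    rewrite expRN lnK ?posrE; last by rewrite addr_gt0 ?invr_gt0.
    have Di : 0 < Delta^-1 by rewrite invr_gt0.
    have DDi : Delta * Delta^-1 = 1 by rewrite mulfV ?gt_eqF.
    by rewrite -[leLHS]mul1r ler_pdivrMr ?addr_gt0 // mulrDr -[X in _ + X]mulrA DDi; lra.
  rewrite leNgt; apply/negP => tail_gt.
  have := few_centers_bound (isT : (0 < m)%N) p_prob C01 eps_gt0 eps_le tail_gt spread cover.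
  apply/negP; rewrite -ltNge.
  (* The two terms of the counting bound are at most [2 / n%:R ^+ 2 <= 2^-1] and
     [expR (- 2) <= 3^-1], with sum below 1. *)
  have bad : n%:R * (2 * expR (- ((eps / (8 * Delta)) ^+ 2 / 8 * m%:R))) <= 2^-1.
    have exp_le : expR (- ((eps / (8 * Delta)) ^+ 2 / 8 * m%:R)) <= (n%:R ^+ 3)^-1.
      rewrite -[n%:R in leRHS]lnK ?posrE; last by lra.
      rewrite -expRM_natl -expRN ler_expR lerN2.
      have -> : (eps / (8 * Delta)) ^+ 2 / 8 * m%:R = m%:R / (512 * d).
        by rewrite /d; field; rewrite !gt_eqF.
      rewrite ler_pdivlMr; last by lra.
      by apply: le_trans (ltW m_gt); rewrite /X le_eqVlt; apply/orP; left; apply/eqP; ring.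
    apply: (@le_trans _ _ (n%:R * (2 * (n%:R ^+ 3)^-1))).
      by rewrite !ler_wpM2l.
    have -> : n%:R * (2 * (n%:R ^+ 3)^-1) = 2 / n%:R ^+ 2 :> R.
      by field; rewrite gt_eqF //; lra.
    by rewrite ler_pdivrMr ?exprn_gt0 //; [nra | lra].
  have covered : (size s)%:R * (2 ^+ m)^-1 <= expR (- 2) :> R.
    rewrite ler_pdivrMr ?exprn_gt0 //; apply: (le_trans size_s).
    rewrite -[n%:R in leLHS]lnK ?posrE; last by lra.
    rewrite -expRM; apply: le_trans (ler_wpM2l (expR_ge0 _) (expR_half_nat_le R m)).
    by rewrite -exp.expRD ler_expR mulrC -/d -/X; lra.
  have : expR (- 2) <= 3^-1 :> R.
    rewrite expRN lef_pV2 ?posrE ?expR_gt0 //.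
    by apply: le_trans (expR_ge1Dx _); clear; lra.
  by move=> expN2; apply: le_lt_trans (lerD bad (le_trans covered expN2)) _; clear; lra.
have [p' [p'_prob card_p' close]] := concentrate H p_prob.
exists p'; split=> //; last exact: le_trans tail.
have : #|supp p'|%:R <= (T * m).+1%:R :> R.
  by rewrite ler_nat (leq_trans card_p').
rewrite -natr1 natrM => /le_trans; apply.
(* The product is at most [27684 * (l * X)], and the extra point costs at most [4 * (l * X)];
   [128 * 256 = 32768] covers both. *)
have Tm : T%:R * m%:R <= 18 * l * (1538 * X) :> R by apply: ler_pM.
have lX : 2^-1 * 2^-1 <= l * X by apply: ler_pM.
have -> : (128 * 256) * d * l * ln n%:R = (128 * 256) * (l * X) by rewrite /X; ring.
have eq18 : 18 * l * (1538 * X) = (18 * 1538) * (l * X) by ring.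
by move: Tm lX; rewrite eq18; clear; lra.
Qed.

(** * Equilibria of stable games *)

(** The centers are the row strategies of the listed equilibria: an admissible [p'] forms with [q]
    an equilibrium of an [eps / 2]-perturbation, so stability puts a center within [Delta]. *)
Lemma NE_small_support_row (R : realType) (n : nat) (eps Delta : R)
    (Rm Cm : 'M[R]_n) (p q : {ffun 'I_n -> R}) :
  (2 <= n)%N -> 0 < eps -> eps <= Delta -> Delta <= 1 ->
  payoffs01 Rm Cm -> at_most_NE (n%:R `^ ((Delta / eps) ^+ 2)) Rm Cm ->
  stable_pert (eps / 2) Delta Rm Cm -> is_NE Rm Cm p q ->
  exists p', [/\ prob p',
    #|supp p'|%:R <= (128 * 256) * (Delta / eps) ^+ 2 * ln (1 + Delta^-1) * ln n%:R
    & dist p p' <= 8 * Delta].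
Proof.
move=> n_ge2 eps_gt0 eps_le D_le1 pay01 [s [size_s allNE]] stab ne.
apply: (@cover_small_support _ _ Cm eps _ _ [seq x.1 | x <- s]) => //.
- by case: ne.
- by move=> i j; case: (pay01 i j).
- by rewrite size_map.
move=> p' p'_prob sub close.
have eps2_ge0 : 0 <= eps / 2 by lra.
have [Cm' [pert ne']] := NE_shift_row eps2_ge0 ne p'_prob sub close.
have [x [y [nexy]]] := stab _ _ pert _ _ ne'.
rewrite /dist2 ge_max => /andP[closex _].
by apply/hasP; exists x => //; apply/mapP; exists (x, y) => //; apply: allNE.
Qed.

Lemma at_most_NE_tr (R : realType) (n : nat) (K : R) (Rm Cm : 'M[R]_n) :
  at_most_NE K Rm Cm -> at_most_NE K Cm^T Rm^T.
Proof.
move=> [s [size_s allNE]]; exists [seq (x.2, x.1) | x <- s]; rewrite size_map.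
split=> // q p /NE_tr; rewrite !trmxK => /allNE pq.
by apply/mapP; exists (p, q).
Qed.

Lemma NE_close_small_support (R : realType) (n : nat) (eps Delta : R)
    (Rm Cm : 'M[R]_n) (p q : {ffun 'I_n -> R}) :
  (2 <= n)%N -> 0 < eps -> eps <= Delta -> Delta <= 1 ->
  payoffs01 Rm Cm -> at_most_NE (n%:R `^ ((Delta / eps) ^+ 2)) Rm Cm ->
  stable_pert (eps / 2) Delta Rm Cm -> is_NE Rm Cm p q ->
  close_small_support (8 * Delta)
    ((128 * 256) * (Delta / eps) ^+ 2 * ln (1 + Delta^-1) * ln n%:R) p q.
Proof.
move=> n_ge2 eps_gt0 eps_le D_le1 pay01 few stab ne.
have [p' [p'_prob card_p' closep]] :=
  NE_small_support_row n_ge2 eps_gt0 eps_le D_le1 pay01 few stab ne.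
have pay01' : payoffs01 Cm^T Rm^T by move=> i j; rewrite !mxE; case: (pay01 j i).
have [q' [q'_prob card_q' closeq]] :=
  NE_small_support_row n_ge2 eps_gt0 eps_le D_le1 pay01' (at_most_NE_tr few)
    (stable_pert_tr stab) (NE_tr ne).
by exists p', q'; split=> //; rewrite /dist2 ge_max closep closeq.
Qed.

Theorem theorem3 :
  exists a b : Rdefinitions.R, 0 < a /\ 0 < b /\
  forall (eps Delta : Rdefinitions.R) (n : nat) (Rm Cm : 'M[Rdefinitions.R]_n),
    (2 <= n)%N ->
    0 < eps -> eps <= Delta -> Delta <= 1 ->
    payoffs01 Rm Cm ->
    at_most_NE ((n%:R) `^ (a * (Delta / eps) ^+ 2)) Rm Cm ->
    (ws_approx_stable eps Delta Rm Cm \/ stable_pert (eps / 2) Delta Rm Cm) ->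
    let k := b * (Delta / eps) ^+ 2 * ln (1 + Delta^-1) * ln (n%:R) in
    (forall p q, is_NE Rm Cm p q -> close_small_support (8 * Delta) k p q) /\
    (forall Rm' Cm', perturb (eps / 2) Rm Cm Rm' Cm' ->
       forall p q, is_NE Rm' Cm' p q -> close_small_support (9 * Delta) k p q).
Proof.
exists 1, (128 * 256); do 2![split; first lra].
move=> eps Delta n Rm Cm n_ge2 eps_gt0 eps_le D_le1 pay01.
rewrite mul1r => few stability k.
have stab : stable_pert (eps / 2) Delta Rm Cm.
  by case: stability => // /ws_approx_stable_pert.
have exact_NE p q : is_NE Rm Cm p q -> close_small_support (8 * Delta) k p q.
  exact: NE_close_small_support.
split=> // Rm' Cm' pert p q /(stab _ _ pert) [x [y [nexy closexy]]].
have [p' [q' [p'_prob q'_prob card_p' card_q' close]]] := exact_NE _ _ nexy.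
(* [9 = 1 + 8]: stability leads to an exact equilibrium [(x, y)], whose sparse approximation is then
   reused. *)
exists p', q'; split=> //; apply: le_trans (dist2_triangle p q x y p' q') _.
by apply: le_trans (lerD closexy close) _; lra.
Qed.
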